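(* Let $R_n$ be any bounded relaxation of $\mathrm{QAP}_n$ (a polytope in $\mathbb{R}^{n^2\times n^2}$ containing $\mathrm{QAP}_n$) such that all inequalities $$-(\beta-1)\!\!\sum_{(ij)\in P_1\times Q}\!\!Y_{ij,ij}+\beta\!\!\sum_{(ij)\in P_2\times Q}\!\!Y_{ij,ij}+\!\!\sum_{\substack{i<k\\(ij),(kl)\in P_1\times Q}}\!\!Y_{ij,kl}+\!\!\sum_{\substack{i<k\\(ij),(kl)\in P_2\times Q}}\!\!Y_{ij,kl}-\!\!\sum_{\substack{(ij)\in P_1\times Q\\(kl)\in P_2\times Q}}\!\!Y_{ij,kl}-\frac{\beta^2-\beta}{2}\geqslant 0$$ are valid for $R_n$, where $P_1,P_2,Q\subset[n]$, $P_1\cap P_2=\emptyset$, $\beta$ is an integer, and (i) $3\leqslant|Q|\leqslant n-3$, (ii) $|P_1|+|P_2|\leqslant n-3$, (iii) $|P_1|\geqslant\min\{2,\beta+1\}$, (iv) $|P_2|\geqslant\min\{1,-\beta+2\}$, (v) $\big||P_1|-|P_2|-\beta\big|\leqslant n-|Q|-4$, (vi) if $|P_2|=1$ then $|Q|\geqslant\min\{-\beta+5,\beta+2\}$, and if $|P_2|\geqslant 2$ then $|Q|\geqslant\min\{-\beta+5,\beta+3\}$ or $|Q|\geqslant\min\{-\beta+4,\beta+4\}$. Then $\mathrm{xc}(R_n)\geqslant 2^{\Omega(n)}$.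
   Context: $P_\sigma$ is the $n\times n$ permutation matrix of $\sigma\in S_n$ ($P_\sigma(i,j)=1$ iff $\sigma(i)=j$). Matrices in $\mathbb{R}^{n^2\times n^2}$ have rows and columns indexed by pairs $(ij)$, $i,j\in[n]$; $Y_{ij,kl}$ is the entry in row $(ij)$, column $(kl)$. $P^{[2]}_\sigma(ij,kl)=P_\sigma(i,j)P_\sigma(k,l)$ and $\mathrm{QAP}_n=\mathrm{conv}\{P^{[2]}_\sigma:\sigma\in S_n\}$. A polytope $Q\subset\mathbb{R}^{d+r}$ is an extension of a polytope $P\subset\mathbb{R}^d$ if $P=\{x:\exists y,\ (x,y)\in Q\}$; the extension complexity $\mathrm{xc}(P)$ is the minimum number of facets of an extension of $P$.
   Formalization: With the printed sign of the constant, QAP_n itself violates the inequalities (e.g. β=2, |P_1|=2, P_2 empty, |Q|=3), so no such R_n exists for n≥7; the formal theorem proves the bound if either the printed family or the family with +(β²−β)/2 is valid for R_n. *)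

(* Defs.v *)
From HB Require Import structures.
From mathcomp Require Import all_boot all_order all_algebra all_fingroup.
From mathcomp Require Import all_classical all_reals all_analysis.
Set Implicit Arguments.
Unset Strict Implicit.
Unset Printing Implicit Defensive.
Import Order.TTheory GRing.Theory Num.Theory.
Local Open Scope classical_set_scope.
Local Open Scope ring_scope.

Section Polytopes.
Variable R : realType.

Definition conv_hull (V : lmodType R) (S : set V) : set V :=
  [set x | exists (m : nat) (lam : 'I_m -> R) (v : 'I_m -> V),
     [/\ forall i, 0 <= lam i, \sum_i lam i = 1, forall i, S (v i)
       & x = \sum_i lam i *: v i]].

Definition polyhedron (d : nat) (P : set 'rV[R]_d) : Prop :=
  exists (m : nat) (A : 'M[R]_(d, m)) (b : 'rV[R]_m),
    P = [set x | forall j, (x *m A) 0 j <= b 0 j].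

Definition polytope (d : nat) (P : set 'rV[R]_d) : Prop :=
  polyhedron P /\ exists M : R, forall x, P x -> forall j, `|x 0 j| <= M.

(* The affine hull of [S] is [x0 + U] with [U] of dimension [k]; in particular
   [S] is nonempty. *)
Definition has_affdim (d : nat) (S : set 'rV[R]_d) (k : nat) : Prop :=
  exists (x0 : 'rV[R]_d) (U : 'M[R]_d),
    [/\ S x0, \rank U = k,
        forall x, S x -> (x - x0 <= U)%MS
      & forall W : 'M[R]_d, (forall x, S x -> (x - x0 <= W)%MS) -> (U <= W)%MS].

Definition face (d : nat) (P F : set 'rV[R]_d) : Prop :=
  exists (a : 'cV[R]_d) (b : R),
    (forall x, P x -> (x *m a) 0 0 <= b) /\
    F = [set x | P x /\ (x *m a) 0 0 = b].

Definition facets (d : nat) (P : set 'rV[R]_d) : set (set 'rV[R]_d) :=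
  [set F | face P F /\ exists k, has_affdim P k.+1 /\ has_affdim F k].

Definition extension (d r : nat) (P : set 'rV[R]_d) (Q : set 'rV[R]_(d + r)) :
  Prop := polytope Q /\ P = [set x | exists y : 'rV[R]_r, Q (row_mx x y)].

(* The infimum is a minimum: it is taken over a set of natural numbers, which
   is nonempty when [P] is a polytope, since [P] is an extension of itself. *)
Definition xc (d : nat) (P : set 'rV[R]_d) : \bar R :=
  ereal_inf [set k%:R%:E | k in [set k : nat |
    exists (r : nat) (Q : set 'rV[R]_(d + r)), extension P Q /\ (facets Q #= `I_k)%card]].

End Polytopes.

Section QAP.
Variables (R : realType) (n : nat).

(* The pair [(ij)] is encoded by the index [mxvec_index i j : 'I_(n * n)]. *)
Definition entry (Y : 'M[R]_(n * n)) (i j k l : 'I_n) : R :=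
  Y (mxvec_index i j) (mxvec_index k l).

(* [perm_mx s i j = (s i == j)%:R] and [mxvec A 0 (mxvec_index i j) = A i j]. *)
Definition perm_mx2 (s : 'S_n) : 'M[R]_(n * n) :=
  \matrix_(a, b) (mxvec (perm_mx s) 0 a * mxvec (perm_mx s) 0 b).

Definition QAP : set 'M[R]_(n * n) := conv_hull (range perm_mx2).

Definition box_form (P1 P2 Q : {set 'I_n}) (beta : int) (Y : 'M[R]_(n * n)) : R :=
  - (beta%:~R - 1) * (\sum_(i in P1) \sum_(j in Q) entry Y i j i j)
  + beta%:~R * (\sum_(i in P2) \sum_(j in Q) entry Y i j i j)
  + (\sum_(i in P1) \sum_(k in P1 | (i < k)%N)
       \sum_(j in Q) \sum_(l in Q) entry Y i j k l)
  + (\sum_(i in P2) \sum_(k in P2 | (i < k)%N)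
       \sum_(j in Q) \sum_(l in Q) entry Y i j k l)
  - (\sum_(i in P1) \sum_(k in P2)
       \sum_(j in Q) \sum_(l in Q) entry Y i j k l).

Definition box_const (beta : int) : R := (beta%:~R ^+ 2 - beta%:~R) / 2.

(* Cardinalities are cast to [int], so that no subtraction is truncated. *)
Definition box_params (P1 P2 Q : {set 'I_n}) (beta : int) : Prop :=
  let p1 : int := #|P1|%:Z in
  let p2 : int := #|P2|%:Z in
  let q : int := #|Q|%:Z in
  let N : int := n%:Z in
  P1 :&: P2 = finset.set0 /\
  3 <= q <= N - 3 /\
  p1 + p2 <= N - 3 /\
  Num.min 2 (beta + 1) <= p1 /\
  Num.min 1 (- beta + 2) <= p2 /\
  `|p1 - p2 - beta| <= N - q - 4 /\
  (p2 = 1 -> Num.min (- beta + 5) (beta + 2) <= q) /\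
  (2 <= p2 -> Num.min (- beta + 5) (beta + 3) <= q \/
              Num.min (- beta + 4) (beta + 4) <= q).

End QAP.

Arguments QAP : clear implicits.

(* Main.v *)
Require Import Defs.
From HB Require Import structures.
From mathcomp Require Import all_boot all_order all_algebra all_fingroup.
From mathcomp Require Import all_classical all_reals all_analysis.
From mathcomp Require Import ring lra zify.
Set Implicit Arguments.
Unset Strict Implicit.
Unset Printing Implicit Defensive.
Import Order.TTheory GRing.Theory Num.Theory.

(** At the permutation matrix of s the left-hand side of the inequality, with the
    constant added, is (T - beta) (T - beta + 1) / 2, where T is the difference
    of the numbers of elements of P1 and of P2 that s maps into Q. With the
    constant subtracted it is violated at some permutation for beta = 2, so that
    hypothesis is contradictory.

    For P2 empty and beta = 2 the slack is (T - 1) (T - 2) / 2. Fixing Q, letting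
    P1 range over the sets a and s^-1(Q) over the sets b (up to padding), one has
    T = |a :&: b|, so the slack is positive if a and b are disjoint and vanishes
    if they meet in one element. In an extension of the polytope, a facet F yields
    the rectangle of all (a, b) such that F contains the face cut out by the
    inequality of a but not the lift of the vertex of b. No rectangle contains a
    pair meeting in one element, and every disjoint pair is covered, because a
    face is the intersection of the facets containing it. By Kaibel and Weltge a
    rectangle of this kind contains at most 2^m of the 3^m disjoint pairs, whence
    at least (3/2)^m facets. *)

(** * Disjoint pairs of sets, coded as bit strings, and rectangles *)

Fixpoint disjoint_pairs (m : nat) : seq (seq bool * seq bool) :=
  if m is m'.+1 then
    [seq (false :: p.1, false :: p.2) | p <- disjoint_pairs m'] ++
    [seq (true :: p.1, false :: p.2) | p <- disjoint_pairs m'] ++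
    [seq (false :: p.1, true :: p.2) | p <- disjoint_pairs m']
  else [:: ([::], [::])].

(** Size of the intersection; bits past the end of a string count as absent. *)
Fixpoint common (s t : seq bool) : nat :=
  if s is x :: s' then if t is y :: t' then (x && y) + common s' t' else 0 else 0.

Lemma size_disjoint_pairs m : size (disjoint_pairs m) = 3 ^ m.
Proof.
by elim: m => //= m IH; rewrite !size_cat !size_map IH expnS !mulSn mul0n addn0.
Qed.

Lemma mem_disjoint_pairs m p :
  p \in disjoint_pairs m -> size p.1 = m /\ common p.1 p.2 = 0.
Proof.
elim: m p => [|m IH] p /=; first by rewrite inE => /eqP->.
by rewrite !mem_cat => /or3P[] /mapP[q /IH[<- qm] ->] /=.
Qed.

Lemma sum_disjoint_pairsS m (F : seq bool * seq bool -> nat) :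
  \sum_(p <- disjoint_pairs m.+1) F p =
  \sum_(p <- disjoint_pairs m) (F (false :: p.1, false :: p.2) +
    F (true :: p.1, false :: p.2) + F (false :: p.1, true :: p.2)).
Proof. by rewrite /= !big_cat !big_map !big_split /= addnA. Qed.

(* Kaibel and Weltge: a disjoint pair (s, t) of length m has three disjoint
   extensions, but the two that put the new element in one of the sets cannot
   both lie in A x B, since then so would the pair meeting exactly in the new
   element. *)
Lemma rectangle_disjoint_pairs m (A B : seq bool -> bool) :
  (forall s t, A s -> B t -> common s t <> 1) ->
  \sum_(p <- disjoint_pairs m) (A p.1 && B p.2 : nat) <= 2 ^ m.
Proof.
elim: m A B => [|m IH] A B AB /=; first by rewrite big_seq1; case: (_ && _).
rewrite sum_disjoint_pairsS expnS mul2n -addnn.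
(* [h1] merges both values of the new bit of [s] while that of [t] is off, [h2] the reverse; the
   three extensions of a pair are charged to these two. *)
have h1 := IH (fun s => A (false :: s) || A (true :: s)) (fun t => B (false :: t)).
have h2 := IH (fun s => A (false :: s)) (fun t => B (false :: t) || B (true :: t)).
apply: leq_trans (leq_add (h1 _) (h2 _)); last 2 first.
- by move=> s t /orP[] As Bt; have := AB _ _ As Bt.
- by move=> s t As /orP[] Bt; have := AB _ _ As Bt.
rewrite -big_split /= big_seq [leqRHS]big_seq; apply: leq_sum => -[s t] /=.
move=> /mem_disjoint_pairs[_ /= st0]; move: (AB (true :: s) (true :: t)).
rewrite /= st0 addn0.
by case: (A _); case: (A _); case: (B _); case: (B _) => // /(_ isT isT).
Qed.

(** Double counting: all [3 ^ m] disjoint pairs are covered, and each of the [k] rectangles holds at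
    most [2 ^ m] of them. *)
Lemma rectangle_cover m k (A B : 'I_k -> seq bool -> bool) :
  (forall i s t, A i s -> B i t -> common s t <> 1) ->
  (forall s t, size s = m -> common s t = 0 -> exists i, A i s && B i t) ->
  3 ^ m <= k * 2 ^ m.
Proof.
move=> AB cov; rewrite -size_disjoint_pairs -sum1_size.
apply: (@leq_trans (\sum_(i < k) 2 ^ m)); last by rewrite sum_nat_const card_ord.
apply: (@leq_trans (\sum_(i < k)
  \sum_(p <- disjoint_pairs m) (A i p.1 && B i p.2 : nat))); last first.
  by apply: leq_sum => i _; exact: rectangle_disjoint_pairs (AB i).
rewrite exchange_big /= big_seq [leqRHS]big_seq; apply: leq_sum => p pm.
have [sp cp] := mem_disjoint_pairs pm; have [i Hi] := cov _ _ sp cp.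
by rewrite (bigD1 i) //= Hi.
Qed.

Local Open Scope classical_set_scope.
Local Open Scope ring_scope.

(** * Polyhedra: dimension, facets, separating a point from a face *)

Section Polyhedra.
Variable R : realType.

Definition affine_fun (V : lmodType R) (f : V -> R) : Prop :=
  forall (t : R) (x y : V), f (x + t *: (y - x)) = f x + t * (f y - f x).

Lemma small_step (I : finType) (al be : I -> R) :
  (forall i, 0 < al i) -> exists2 e, 0 < e & forall i, e * be i <= al i.
Proof.
move=> al0; pose s := \sum_i `|be i| / al i.
have s0 : 0 <= s by apply: sumr_ge0 => i _; rewrite divr_ge0 // ltW.
(* Every [be i] is at most [al i * s]. *)
exists (1 + s)^-1 => [|i]; first by rewrite invr_gt0; lra.
rewrite mulrC ler_pdivrMr; last by lra.
have /le_trans -> // : be i <= al i * s.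
  rewrite -ler_pdivrMl // mulrC.
  apply: (@le_trans _ _ (`|be i| / al i)).
    by rewrite ler_pM2r ?invr_gt0 // ler_norm.
  by rewrite /s (bigD1 i) //= lerDl sumr_ge0 // => j _; rewrite divr_ge0 // ltW.
by rewrite mulrDr mulr1 lerDr ltW.
Qed.

(** A relative interior point: averaging with a witness for each [f i] not identically zero keeps
    positive what was already positive. *)
Lemma generic_point (V : lmodType R) (I : finType) (S : set V) (f : I -> V -> R) :
  S !=set0 ->
  (forall x y t, 0 <= t <= 1 -> S x -> S y -> S (x + t *: (y - x))) ->
  (forall i, affine_fun (f i)) ->
  (forall i x, S x -> 0 <= f i x) ->
  exists2 c, S c & forall i, f i c = 0 -> forall x, S x -> f i x = 0.
Proof.
move=> [x0 Sx0] cvxS aff f0.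
suff [c Sc cP] : exists2 c, S c &
    forall i, i \in enum I -> f i c = 0 -> forall x, S x -> f i x = 0.
  by exists c => // i; apply: cP; rewrite mem_enum.
elim: (enum I) => [|i l [c Sc IH]]; first by exists x0.
have [fi0|/existsNP[x /not_implyP[Sx fx]]] := pselect (forall x, S x -> f i x = 0).
  by exists c => // j; rewrite inE => /predU1P[->|/IH].
exists (c + 2^-1 *: (x - c)); first by apply: cvxS => //; lra.
move=> j; rewrite aff inE => /predU1P[->|jl].
  have := f0 i _ Sc; have := f0 i _ Sx => fx0 fc0 e0.
  by exfalso; apply: fx; lra.
have := f0 j _ Sc; have := f0 j _ Sx => fx0 fc0 e0.
by apply: IH => //; lra.
Qed.

Section System.
Variables (d m : nat) (A : 'M[R]_(d, m)) (b : 'rV[R]_m).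

Definition slack (j : 'I_m) (x : 'rV[R]_d) : R := b 0 j - (x *m A) 0 j.

Definition solutions : set 'rV[R]_d := [set x | forall j, 0 <= slack j x].

Lemma mulmx_col0 (u : 'rV[R]_d) j : (u *m col j A) 0 0 = (u *m A) 0 j.
Proof. by rewrite !mxE; apply: eq_bigr => i _; rewrite mxE. Qed.

Lemma slackD j x u : slack j (x + u) = slack j x - (u *m A) 0 j.
Proof. by rewrite /slack mulmxDl mxE; ring. Qed.

Lemma slackDZ j x e u : slack j (x + e *: u) = slack j x - e * (u *m A) 0 j.
Proof. by rewrite slackD -scalemxAl mxE. Qed.

Lemma slack_affine j : affine_fun (slack j).
Proof.
by move=> t x y; rewrite slackDZ /slack mulmxBl !mxE; ring.
Qed.

Lemma slackB j x y : ((x - y) *m A) 0 j = slack j y - slack j x.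
Proof. by rewrite /slack mulmxBl !mxE; ring. Qed.

(** Strictness at [p] leaves room to move a little along every row of [U], so the directions of the
    affine hull fill [U]. *)
Lemma has_affdim_solutions (E J : {set 'I_m}) (U : 'M[R]_d) (p : 'rV[R]_d) :
  (forall u : 'rV[R]_d, (u <= U)%MS <-> forall j, j \in E -> (u *m A) 0 j = 0) ->
  (forall x, (forall j, j \in E -> slack j x = 0) ->
             (forall j, j \in J -> 0 <= slack j x) -> solutions x) ->
  (forall j, j \in E -> slack j p = 0) ->
  (forall j, j \in J -> 0 < slack j p) ->
  has_affdim [set x | solutions x /\ forall j, j \in E -> slack j x = 0] (\rank U).
Proof.
move=> UP EJ pE pJ; exists p, U; split => //.
- by split => //; apply: EJ => // j /pJ/ltW.
- by move=> x [_ xE]; apply/UP => j jE; rewrite slackB pE ?xE // subr0.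
move=> W WP; apply/row_subP => i.
have /UP uE : (row i U <= U)%MS by exact: row_sub.
set u := row i U in uE *.
have [e e0 eP] := @small_step {j | j \in J} (fun j => slack (val j) p)
  (fun j => (u *m A) 0 (val j)) (fun j => pJ _ (valP j)).
have eE j : j \in E -> slack j (p + e *: u) = 0.
  by move=> jE; rewrite slackDZ pE // uE // mulr0 subr0.
have /WP : solutions (p + e *: u) /\ forall j, j \in E -> slack j (p + e *: u) = 0.
  split => //; apply: EJ => // j jJ; rewrite slackDZ subr_ge0.
  exact: (eP (exist _ j jJ)).
by rewrite addrAC subrr add0r eqmx_scale // gt_eqF.
Qed.

Lemma face_slack j : face solutions [set x | solutions x /\ slack j x = 0].
Proof.
exists (col j A), (b 0 j); split => [x /(_ j)|]; first by rewrite mulmx_col0 subr_ge0.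
apply/seteqP; split => x /= [Qx xj]; split => //; move: xj; rewrite /slack mulmx_col0.
  by move=> /eqP; rewrite subr_eq0 => /eqP ->.
by move=> ->; rewrite subrr.
Qed.

(* Take a minimal subsystem J defining the polyhedron inside its affine hull:
   each inequality of J then defines a facet. *)
Lemma facet_system : solutions !=set0 ->
  exists E J : {set 'I_m},
  [/\ forall x, solutions x -> forall j, j \in E -> slack j x = 0,
      forall x, (forall j, j \in E -> slack j x = 0) ->
                (forall j, j \in J -> 0 <= slack j x) -> solutions x
    & forall j, j \in J -> facets solutions [set x | solutions x /\ slack j x = 0]].
Proof.
move=> Q0.
have [|||w Qw wP] := @generic_point _ 'I_m solutions slack Q0.
- move=> x y t t01 Qx Qy j; rewrite slack_affine.
  by have := Qx j; have := Qy j => ? ?; nra.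
- exact: slack_affine.
- by move=> j x; apply.
(* As [w] is generic, [E] collects the implicit equalities. *)
pose E := finset (fun j => slack j w == 0).
have QE x : solutions x -> forall j, j \in E -> slack j x = 0.
  by move=> Qx j; rewrite inE => /eqP /wP; apply.
pose ok (J : {set 'I_m}) := `[< forall x, (forall j, j \in E -> slack j x = 0) ->
  (forall j, j \in J -> 0 <= slack j x) -> solutions x >].
have okE : ok (~: E)%SET.
  apply/asboolP => x xE xJ j; have [jE|jE] := boolP (j \in E).
    by rewrite xE.
  by apply: xJ; rewrite inE.
have [J /minsetP[/asboolP Jok Jmin] JE] := minset_exists okE.
exists E, J; split=> // j jJ.
have wJ i : i \in J -> 0 < slack i w.
  move=> /(fintype.subsetP JE); rewrite !inE => wi; rewrite lt_neqAle eq_sym wi.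
  exact: Qw.
(* Minimality of [J]: dropping [j] admits some [y] that violates [j] alone among [J]. *)
have [y [yE yJ yj]] : exists y, [/\ forall i, i \in E -> slack i y = 0,
    forall i, i \in J -> i != j -> 0 <= slack i y & slack j y < 0].
  have : ~~ ok (J :\ j)%SET.
    apply/negP => /Jmin /(_ (subsetDl _ _)) /setP /(_ j).
    by rewrite !inE eqxx jJ.
  move=> /asboolPn /existsNP[y /not_implyP[yE /not_implyP[yJ Qy]]].
  exists y; split => // [i iJ ij|]; first by apply: yJ; rewrite !inE ij.
  rewrite ltNge; apply/negP => yj; apply: Qy; apply: Jok => // i iJ.
  by have [->//|ij] := eqVneq i j; apply: yJ; rewrite !inE ij.
(* The segment from [w] to [y] meets the hyperplane of [j] at parameter [t]; the other slacks in [J]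
   are still positive there. *)
pose t := slack j w / (slack j w - slack j y).
have wj := wJ _ jJ.
have tP : t * (slack j y - slack j w) = - slack j w.
  by rewrite /t; field; rewrite subr_eq0; lra.
have t0 : 0 < t by rewrite divr_gt0 //; lra.
have t1 : t < 1 by rewrite /t ltr_pdivrMr; lra.
pose p := w + t *: (y - w).
have pE i : i \in E -> slack i p = 0.
  by move=> iE; rewrite slack_affine yE // (QE _ Qw) // subrr mulr0 addr0.
have pj : slack j p = 0 by rewrite slack_affine tP subrr.
have pJ i : i \in J -> i != j -> 0 < slack i p.
  move=> iJ ij; rewrite slack_affine.
  by have := yJ i iJ ij; have := wJ i iJ => ? ?; nra.
pose U := kermx (\matrix_(i, k) (if k \in E then A i k else 0)).
have UP (u : 'rV[R]_d) : (u <= U)%MS <-> forall k, k \in E -> (u *m A) 0 k = 0.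
  split => [/sub_kermxP u0 k kE|uE].
    move/rowP: u0 => /(_ k); rewrite !mxE; apply: etrans.
    by apply: eq_bigr => i _; rewrite !mxE kE.
  apply/sub_kermxP/rowP => k; rewrite !mxE.
  have [kE|kE] := boolP (k \in E).
    have := uE _ kE; rewrite mxE; apply: etrans.
    by apply: eq_bigr => i _; rewrite mxE kE.
  by rewrite big1 // => i _; rewrite mxE (negbTE kE) mulr0.
pose Uj := (U :&: kermx (col j A))%MS.
have colP (u : 'rV[R]_d) : (u <= kermx (col j A))%MS <-> (u *m A) 0 j = 0.
  split => [/sub_kermxP u0|u0]; first by rewrite -mulmx_col0 u0 mxE.
  by apply/sub_kermxP/matrixP => i k; rewrite !ord1 mulmx_col0 u0 mxE.
have UjP (u : 'rV[R]_d) :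
    (u <= Uj)%MS <-> forall k, k \in (j |: E)%SET -> (u *m A) 0 k = 0.
  rewrite sub_capmx; split => [/andP[/UP uE /colP uj] k|uE].
    by rewrite !inE => /predU1P[->//|kE]; apply: uE; rewrite inE.
  apply/andP; split; first by apply/UP => k kE; apply: uE; apply/setU1P; right.
  by apply/colP; apply: uE; rewrite !inE eqxx.
(* [y - w] lies in [U] and changes the slack of [j], so the hyperplane lowers the rank by exactly
   one. *)
have rkU : \rank U = (\rank Uj).+1.
  rewrite -(mxrank_mul_ker U (col j A)).
  suff -> : \rank (U *m col j A) = 1%N by [].
  apply/eqP; rewrite eqn_leq rank_leq_col lt0n mxrank_eq0; apply/eqP => U0.
  have /submxP[v vE] : (y - w <= U)%MS.
    by apply/UP => k kE; rewrite slackB yE // (QE _ Qw) // subrr.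
  have /colP : (y - w <= kermx (col j A))%MS.
    by apply/sub_kermxP; rewrite vE -mulmxA U0 mulmx0.
  by rewrite slackB => /eqP; rewrite subr_eq0 => /eqP; lra.
split; first exact: face_slack.
exists (\rank Uj); split.
  rewrite -rkU; have := @has_affdim_solutions E J U w UP Jok (QE _ Qw) wJ.
  congr has_affdim; apply/seteqP; split => x /=; first by case.
  by move=> Qx; split => //; exact: QE.
have := @has_affdim_solutions (j |: E)%SET (J :\ j)%SET Uj p UjP.
have -> : [set x | solutions x /\ (forall k, k \in (j |: E)%SET -> slack k x = 0)] =
          [set x | solutions x /\ slack j x = 0].
  apply/seteqP; split => x /= [Qx xj]; split => //; first by apply: xj; rewrite !inE eqxx.
  by move=> k /setU1P[->//|]; exact: QE.
apply.
- move=> x xE xJ; apply: Jok => k kI; first by apply: xE; apply/setU1P; right.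
  have [->|kj] := eqVneq k j; last by apply: xJ; rewrite !inE kj.
  by rewrite xE // !inE eqxx.
- by move=> k /setU1P[->//|]; exact: pE.
- by move=> k; rewrite !inE => /andP[kj kJ]; exact: pJ.
Qed.

End System.

Lemma polyhedron_solutions d (P : set 'rV[R]_d) : polyhedron P ->
  exists m (A : 'M[R]_(d, m)) (b : 'rV[R]_m), P = solutions A b.
Proof.
move=> [m [A [b ->]]]; exists m, A, b.
by apply/seteqP; split => x /= xP j; move: (xP j); rewrite /slack subr_ge0.
Qed.

(* Prolong the segment from z to a generic point c of the face beyond c: it
   leaves P at once, so it must cross a facet at c. *)
Lemma facet_separation d (P : set 'rV[R]_d) (h : 'rV[R]_d -> R) z c0 :
  polyhedron P -> affine_fun h -> (forall x, P x -> 0 <= h x) ->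
  P c0 -> h c0 = 0 -> P z -> h z != 0 ->
  exists F, [/\ facets P F, forall x, P x -> h x = 0 -> F x & ~ F z].
Proof.
move=> /polyhedron_solutions[m [A [b ->]]] haff h0 Pc0 hc0 Pz hz.
have [|E [J [QE EJ JF]]] := @facet_system _ _ A b; first by exists c0.
set P' := solutions A b in h0 Pc0 Pz QE JF *.
have [||||c [Pc hc] cP] := @generic_point _ 'I_m [set x | P' x /\ h x = 0] (slack A b).
- by exists c0.
- move=> x y t t01 [Px hx] [Py hy]; split; last by rewrite haff hx hy subrr mulr0 addr0.
  by move=> j; rewrite slack_affine; have := Px j; have := Py j => ? ?; nra.
- exact: slack_affine.
- by move=> j x [/(_ j)].
(* If every inequality of [J] tight at [c] is also tight at [z], a small step past [c] stays in
   [P'], yet makes [h] negative. *)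
have [[j [jJ cj zj]]|nex] :=
    pselect (exists j, [/\ j \in J, slack A b j c = 0 & slack A b j z <> 0]).
  exists [set x | P' x /\ slack A b j x = 0]; split; first exact: JF.
    by move=> x Px hx; split => //; apply: cP.
  by move=> [].
have [|e e0 eP] := @small_step {j | slack A b j c != 0}
    (fun j => slack A b (val j) c) (fun j => slack A b (val j) z - slack A b (val j) c).
  by move=> j; rewrite lt_neqAle eq_sym (valP j) /=; exact: Pc.
have : P' (c + (- e) *: (z - c)).
  apply: EJ => j jI; rewrite slack_affine.
    by rewrite (QE _ Pz) // (QE _ Pc) // subrr mulr0 addr0.
  have [cj|cj] := eqVneq (slack A b j c) 0.
    have zj : slack A b j z = 0.
      by apply/eqP; apply: contra_notT nex => /eqP zj; exists j.
    by rewrite cj zj subrr mulr0 addr0.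
  by have := eP (exist _ j cj) => /=; lra.
move=> /h0; rewrite haff hc subr0 add0r mulNr oppr_ge0 => hneg.
have hz0 : 0 < h z by rewrite lt_neqAle eq_sym hz h0.
by have := mulr_gt0 e0 hz0; lra.
Qed.

End Polyhedra.

(** * Index sets and permutations coded by bit strings *)

Lemma common_leq_size s t : (common s t <= size s)%N.
Proof.
elim: s t => //= x s IH [|y t] //; have := IH t; case: (_ && _) => ?; lia.
Qed.

Lemma count_common s t M : (size s <= M)%N ->
  count (fun i => nth false s i && nth false t i) (iota 0 M) = common s t.
Proof.
elim: M s t => [|M IH] [|x s] [|y t] //= sM.
- by rewrite (@eq_count _ _ pred0) ?count_pred0 // => i /=; rewrite nth_nil.
- by rewrite (@eq_count _ _ pred0) ?count_pred0 // => i /=; rewrite nth_nil.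
- by rewrite andbF (@eq_count _ _ pred0) ?count_pred0 // => i /=; rewrite nth_nil andbF.
by rewrite -[1%N]addn0 iotaDl count_map /= -(IH s t).
Qed.

Lemma card_ord_count n (p : pred nat) :
  #|finset (fun i : 'I_n => p i)| = count p (iota 0 n).
Proof. by rewrite cardsE cardE size_filter -enumT -val_enum_ord count_map. Qed.

Lemma card_ord_common n M s t : (size s <= M)%N -> (M <= n)%N ->
  #|finset (fun i : 'I_n => (i < M)%N && (nth false s i && nth false t i))| = common s t.
Proof.
move=> sM Mn.
rewrite (card_ord_count n (fun i => (i < M)%N && (nth false s i && nth false t i))).
rewrite -(count_common t sM) -(subnKC Mn) iotaD count_cat.
rewrite [X in (_ + X)%N](@eq_in_count _ _ pred0) ?count_pred0 ?addn0; last first.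
  by move=> i; rewrite mem_iota => iM; apply: negbTE; rewrite negb_and -leqNgt; lia.
by apply: eq_in_count => i; rewrite mem_iota add0n => /= ->.
Qed.

Lemma card_ord_interval n M q : (M + q <= n)%N ->
  #|finset (fun i : 'I_n => M <= i < M + q)%N| = q.
Proof.
move=> Mn; rewrite (card_ord_count n (fun i => M <= i < M + q)%N).
rewrite -(subnKC Mn) -addnA !iotaD !count_cat add0n.
rewrite (@eq_in_count _ _ pred0) ?count_pred0; last first.
  by move=> i; rewrite mem_iota /=; lia.
rewrite (@eq_in_count _ _ predT) ?count_predT ?size_iota; last first.
  by move=> i; rewrite mem_iota /=; lia.
rewrite (@eq_in_count _ _ pred0) ?count_pred0 ?addn0 //.
by move=> i; rewrite mem_iota /=; lia.
Qed.

Section Swap.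
Variables (n M : nat) (Mn : (M + M <= n)%N).

(** A product of transpositions of [i] with [M + i]: among the first [M] indices, exactly those in
    [t] go to the second block. *)
Definition swap_nat (t : seq bool) (i : nat) : nat :=
  if (i < M)%N then if nth false t i then (M + i)%N else i
  else if ((i < M + M) && nth false t (i - M))%N then (i - M)%N else i.

Lemma swap_natK t : involutive (swap_nat t).
Proof.
move=> i; rewrite {2}/swap_nat; case: ifPn => iM.
  case: ifPn => ti; rewrite /swap_nat.
    by rewrite ltnNge leq_addr /= ltn_add2l iM addKn ti.
  by rewrite iM (negbTE ti).
case: ifPn => [/andP[iMM ti]|ti]; rewrite /swap_nat.
  have -> : (i - M < M)%N by lia.
  by rewrite ti; lia.
by rewrite (negbTE iM) (negbTE ti).
Qed.

Lemma swap_nat_lt t i : (i < n)%N -> (swap_nat t i < n)%N.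
Proof. by rewrite /swap_nat; do ?case: ifP => ?; lia. Qed.

Definition swap_ord (t : seq bool) (i : 'I_n) : 'I_n :=
  Ordinal (swap_nat_lt t (ltn_ord i)).

Lemma swap_ord_inj t : injective (swap_ord t).
Proof. by apply: inv_inj => i; apply: val_inj; exact: swap_natK. Qed.

Definition swap_perm (t : seq bool) : 'S_n := perm (@swap_ord_inj t).

Definition low (s : seq bool) : {set 'I_n} :=
  finset (fun i : 'I_n => (i < M)%N && nth false s i).

Definition high : {set 'I_n} := finset (fun i : 'I_n => M <= i < M + M)%N.

Lemma card_swap_perm s t : (size s <= M)%N ->
  #|finset (fun i => (i \in low s) && (swap_perm t i \in high))| = common s t.
Proof.
move=> sM; have MN : (M <= n)%N by lia.
rewrite -(card_ord_common t sM MN); congr #|pred_of_set _|.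
apply/setP => i; rewrite !inE permE /= /swap_nat.
have [iM|//] := ltnP i M; case: (nth false s i) => //=.
by case: (nth false t i); lia.
Qed.

Lemma card_low s : (size s <= M)%N -> #|low s| = common s s.
Proof.
move=> sM; have MN : (M <= n)%N by lia.
rewrite -(card_ord_common s sM MN); congr #|pred_of_set _|.
by apply/setP => i; rewrite !inE andbb.
Qed.

(** The bound on [p1 - p2 - beta] is the tight one: it reads [p1 - 2 <= n - M - 4] with [p1] up to
    [M], whence [M + M + 2 <= n]. *)
Lemma box_params_low s : (size s <= M - 2)%N -> (3 <= M)%N -> (M + M + 2 <= n)%N ->
  box_params (low (true :: true :: s)) finset.set0 high 2.
Proof.
move=> sM M3 Mn2; have sM2 : (size [:: true, true & s] <= M)%N by rewrite /=; lia.
have := card_low sM2; have := common_leq_size [:: true, true & s] [:: true, true & s].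
rewrite /= => c1 c2; rewrite /box_params c2 cards0 card_ord_interval // finset.setI0.
by do ?split; lia.
Qed.

End Swap.

(** * The inequality at permutation matrices *)

Section BoxForm.
Variable R : realType.

Lemma box_form_affine n (P1 P2 Q : {set 'I_n}) beta (t : R) (X Y : 'M[R]_(n * n)) :
  box_form P1 P2 Q beta (X + t *: (Y - X)) =
  box_form P1 P2 Q beta X + t * (box_form P1 P2 Q beta Y - box_form P1 P2 Q beta X).
Proof.
have sumA (I : finType) (p : pred I) (f g h : I -> R) :
    (forall i, f i = g i + t * (h i - g i)) ->
    \sum_(i | p i) f i = \sum_(i | p i) g i + t * (\sum_(i | p i) h i - \sum_(i | p i) g i).
  by move=> fE; rewrite -sumrB mulr_sumr -big_split; apply: eq_bigr.
have eA i j k l : entry (X + t *: (Y - X)) i j k l =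
    entry X i j k l + t * (entry Y i j k l - entry X i j k l).
  by rewrite /entry !mxE.
have dA (P : {set 'I_n}) := sumA _ (mem P) _ _ _
  (fun i => sumA _ (mem Q) _ _ _ (fun j => eA i j i j)).
have pA i k := sumA _ (mem Q) _ _ _ (fun j => sumA _ (mem Q) _ _ _ (fun l => eA i j k l)).
have oA (P : {set 'I_n}) := sumA _ (mem P) _ _ _
  (fun i => sumA _ (fun k => (k \in P) && (i < k)%N) _ _ _ (fun k => pA i k)).
have cA := sumA _ (mem P1) _ _ _ (fun i => sumA _ (mem P2) _ _ _ (fun k => pA i k)).
by rewrite /box_form !dA !oA cA; ring.
Qed.

(** The double sum splits into two equal halves and the diagonal; for 0/1 values with sum [T] the
    pair sum becomes [(T ^ 2 - T) / 2]. *)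
Lemma sum_lt_pairs n (P : {set 'I_n}) (x : 'I_n -> R) :
  (\sum_(i in P) x i) ^+ 2 =
  2 * (\sum_(i in P) \sum_(k in P | (i < k)%N) x i * x k) + \sum_(i in P) x i ^+ 2.
Proof.
have -> : (\sum_(i in P) x i) ^+ 2 = \sum_(i in P) \sum_(k in P) x i * x k.
  by rewrite expr2 mulr_suml; apply: eq_bigr => i _; rewrite mulr_sumr.
have gtE : \sum_(i in P) \sum_(k in P | (k < i)%N) x i * x k =
           \sum_(i in P) \sum_(k in P | (i < k)%N) x i * x k.
  rewrite (exchange_big_dep (mem P)) /=; last by move=> i k _ /andP[].
  apply: eq_bigr => k kP; apply: eq_big => [i|i _]; last by rewrite mulrC.
  by rewrite kP.
rewrite mulr_natl mulr2n -{2}gtE -!big_split /=; apply: eq_bigr => i iP.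
rewrite (bigID (fun k : 'I_n => (i < k)%N)) /= -addrA; congr (_ + _).
rewrite (bigD1 i) /= ?iP ?ltnn // addrC -expr2; congr (_ + _).
by apply: eq_bigl => k; case: (k \in P) => //=; rewrite -val_eqE /=; lia.
Qed.

Lemma entry_perm_mx2 n (s : 'S_n) i j k l :
  entry (perm_mx2 R s) i j k l = (s i == j)%:R * (s k == l)%:R.
Proof. by rewrite /entry /perm_mx2 mxE !mxvecE !mxE. Qed.

Lemma sum_eq_in n (Q : {set 'I_n}) (i : 'I_n) :
  \sum_(j in Q) (i == j)%:R = (i \in Q)%:R :> R.
Proof.
have [iQ|iQ] := boolP (i \in Q).
  by rewrite (bigD1 i) //= eqxx big1 ?addr0 // => j /andP[_]; rewrite eq_sym => /negbTE ->.
by rewrite big1 // => j jQ; case: eqP => // ij; rewrite ij jQ in iQ.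
Qed.

Lemma box_form_perm n (P Q : {set 'I_n}) (s : 'S_n) :
  let T := #|finset (fun i => (i \in P) && (s i \in Q))|%:R : R in
  box_form P finset.set0 Q 2 (perm_mx2 R s) + box_const R 2 = (T - 1) * (T - 2) / 2.
Proof.
move=> T; pose x i : R := (s i \in Q)%:R.
have Tx : \sum_(i in P) x i = T.
  rewrite /T cardsE -sum1_card natr_sum big_mkcondr /=.
  by apply: eq_bigr => i _; rewrite /x; case: (_ \in _).
have Dx : \sum_(i in P) \sum_(j in Q) entry (perm_mx2 R s) i j i j = T.
  rewrite -Tx; apply: eq_bigr => i _; rewrite /x -sum_eq_in; apply: eq_bigr => j _.
  by rewrite entry_perm_mx2; case: eqP; rewrite ?mulr0 ?mulr1.
have Ox : \sum_(i in P) \sum_(k in P | (i < k)%N)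
    \sum_(j in Q) \sum_(l in Q) entry (perm_mx2 R s) i j k l =
    \sum_(i in P) \sum_(k in P | (i < k)%N) x i * x k.
  apply: eq_bigr => i _; apply: eq_bigr => k _.
  rewrite /x -!sum_eq_in mulr_suml; apply: eq_bigr => j _; rewrite mulr_sumr.
  by apply: eq_bigr => l _; rewrite entry_perm_mx2.
have x2 : \sum_(i in P) x i ^+ 2 = T.
  by rewrite -Tx; apply: eq_bigr => i _; rewrite /x; case: (_ \in _); rewrite ?expr1n ?expr0n.
have := sum_lt_pairs P x; rewrite Tx x2 => h.
rewrite /box_form /box_const Dx Ox !big_set0.
rewrite [X in _ - X]big1; last by move=> i _; rewrite big_set0.
have -> : (2 : int)%:~R = 2 :> R by [].
by lra.
Qed.

Lemma QAP_perm n (s : 'S_n) : QAP R n (perm_mx2 R s).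
Proof.
exists 1%N, (fun=> 1), (fun=> perm_mx2 R s); split => //.
- by rewrite big_ord1.
- by rewrite big_ord1 scale1r.
Qed.

End BoxForm.

(** * From rectangles to extension complexity *)

Lemma facets_enum (R : realType) d (P : set 'rV[R]_d) k : (facets P #= `I_k)%card ->
  exists g : 'I_k -> set 'rV[R]_d, forall F, facets P F -> exists i, g i = F.
Proof.
move=> /card_set_bijP[f [f1 f2 f3]].
have /choice[g gP] (i : 'I_k) : exists F, facets P F /\ f F = i.
  by have [F] := f3 i (ltn_ord i); exists F.
exists g => F FP; have fF : (f F < k)%N by have /= := f1 _ FP.
exists (Ordinal fF); have [gF /= fg] := gP (Ordinal fF).
by apply: f2 => //; rewrite inE.
Qed.

(* The two leading bits of the inequality's set are fixed to 1 and those of a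
   permutation to 0: this gives |P1| >= 2, and leaves room for a permutation
   meeting P1 exactly once, so that each face used below is nonempty. *)
Lemma facets_lower_bound (R : realType) (n m k r : nat) (Rn : set 'M[R]_(n * n))
    (Qx : set 'rV[R]_(n * n * (n * n) + r)) :
  (0 < m)%N -> (m.+2 + m.+2 + 2 <= n)%N ->
  QAP R n `<=` Rn ->
  (forall (P1 P2 Q : {set 'I_n}) (beta : int), box_params P1 P2 Q beta ->
     forall Y, Rn Y -> box_form P1 P2 Q beta Y + box_const R beta >= 0) ->
  extension (mxvec @` Rn) Qx -> (facets Qx #= `I_k)%card ->
  (3 ^ m <= k * 2 ^ m)%N.
Proof.
move=> m0 mn QAP_Rn valid ext cardQ.
have mn2 : (m.+2 + m.+2 <= n)%N by lia.
pose row1 s := [:: true, true & s]; pose col0 t := [:: false, false & t].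
pose h s (z : 'rV[R]_(n * n * (n * n) + r)) : R :=
  box_form (low n m.+2 (row1 s)) finset.set0 (high n m.+2) 2 (vec_mx (lsubmx z))
  + box_const R 2.
have [[Qpoly _] RnE] := ext.
have h_aff s : affine_fun (h s).
  move=> t x y; rewrite /h linearD linearZ linearB /= linearD linearZ linearB /=.
  by rewrite box_form_affine; ring.
have h_ge0 s z : (size s <= m)%N -> Qx z -> 0 <= h s z.
  move=> sm Qz; have : (mxvec @` Rn) (lsubmx z).
    by rewrite RnE; exists (rsubmx z); rewrite hsubmxK.
  move=> [Y RY Yz]; rewrite /h -Yz mxvecK; apply: valid => //.
  by apply: box_params_low => //; lia.
have /choice[lift liftP] t : exists y, Qx (row_mx (mxvec (perm_mx2 R (swap_perm mn2 t))) y).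
  have : (mxvec @` Rn) (mxvec (perm_mx2 R (swap_perm mn2 t))).
    by exists (perm_mx2 R (swap_perm mn2 t)) => //; apply: QAP_Rn; exact: QAP_perm.
  by rewrite RnE.
pose pt t := row_mx (mxvec (perm_mx2 R (swap_perm mn2 t))) (lift t).
have h_pt s t : (size s <= m)%N ->
    h s (pt t) = ((common (row1 s) t)%:R - 1) * ((common (row1 s) t)%:R - 2) / 2.
  by move=> sm; rewrite /h row_mxKl mxvecK box_form_perm card_swap_perm.
have [g gP] := facets_enum cardQ.
(* The size bound is built into the rectangle because its pairs range over strings of all lengths,
   while [h_pt] needs it. *)
apply: (@rectangle_cover m k
  (fun i s => (size s <= m)%N && `[< forall z, Qx z -> h s z = 0 -> g i z >])
  (fun i t => `[< ~ g i (pt (col0 t)) >])).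
  move=> i s t /andP[sm /asboolP gs] /asboolP gt st1; apply: gt.
  by apply: gs; [exact: liftP | rewrite h_pt //= st1; lra].
move=> s t sm st0; have {}sm : (size s <= m)%N by rewrite sm.
(* [[:: true]] meets [row1 s] in one element, so [h s] vanishes at its point, whereas it equals 1 at
   [pt (col0 t)]. *)
have [||||F [FP Fs Ft]] := @facet_separation _ _ Qx (h s) (pt (col0 t)) (pt [:: true])
  Qpoly (h_aff s) (fun z => h_ge0 s z sm).
- exact: liftP.
- by rewrite h_pt //=; lra.
- exact: liftP.
- by rewrite h_pt //= st0; apply/eqP; lra.
have [i giF] := gP _ FP; exists i; rewrite sm giF /=.
by apply/andP; split; exact/asboolP.
Qed.

(** [k ^ 2 >= (9/4) ^ m >= 2 ^ m], so [k] is at least 2 to the power [m/2 >= n/8]. *)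
Lemma exp_lower_bound (R : realType) (n m k : nat) :
  (3 ^ m <= k * 2 ^ m)%N -> (n <= 4 * m)%N -> 2 `^ (8^-1 * n%:R) <= k%:R :> R.
Proof.
move=> km nm; rewrite -(@ler_pXn2r _ 2) ?nnegrE ?powR_ge0 //.
have km2 : (2 ^ m <= k ^ 2)%N.
  rewrite -(@leq_pmul2r ((2 ^ m) ^ 2)) ?expn_gt0 // -expnMn.
  apply: leq_trans (_ : (3 ^ m) ^ 2 <= _)%N; last by rewrite leq_sqr.
  rewrite -expnS -!expnM [(m * 3)%N]mulnC [(m * 2)%N]mulnC !expnM.
  by have [->//|m0] := posnP m; rewrite leq_exp2r.
apply: (@le_trans _ _ (2 ^+ m)); last by rewrite -!natrX ler_nat.
rewrite -powR_mulrn ?powR_ge0 // -powRrM -powR_mulrn //.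
apply: ler_powR; first by lra.
have : n%:R <= 4 * m%:R :> R by rewrite -natrM ler_nat.
by lra.
Qed.

(* The first disjunct is the inequality as printed; the second has the constant
   term with the sign that makes the inequality valid for QAP_n. The conclusion
   is claimed under either hypothesis. *)
Theorem theorem9 (R : realType) :
  exists c : R, 0 < c /\ exists N : nat, forall n : nat, (N <= n)%N ->
  forall Rn : set 'M[R]_(n * n),
    polytope (mxvec @` Rn) ->
    QAP R n `<=` Rn ->
    (forall (P1 P2 Q : {set 'I_n}) (beta : int), box_params P1 P2 Q beta ->
       forall Y, Rn Y -> box_form P1 P2 Q beta Y - box_const R beta >= 0) \/
    (forall (P1 P2 Q : {set 'I_n}) (beta : int), box_params P1 P2 Q beta ->
       forall Y, Rn Y -> box_form P1 P2 Q beta Y + box_const R beta >= 0) ->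
    ((2 `^ (c * n%:R))%:E <= xc (mxvec @` Rn))%E.
Proof.
exists 8^-1; split; first by lra.
(* From 14 on, [m = n./2 - 3] satisfies both [2m + 6 <= n] and [n <= 4m]; at 13 the latter fails. *)
exists 14 => n n14 Rn _ QRn.
have [m [m0 mn nm]] : exists m, [/\ 0 < m, m.+2 + m.+2 + 2 <= n & n <= 4 * m]%N.
  by exists (n./2 - 3)%N; split; lia.
have mn2 : (m.+2 + m.+2 <= n)%N by lia.
case=> [printed|valid].
  (* With the printed sign, beta = 2 fails at a permutation mapping exactly two
     elements of P1 into Q. *)
  exfalso; have := printed (low n m.+2 [:: true; true]) finset.set0 (high n m.+2) 2 _
    (perm_mx2 R (swap_perm mn2 [:: true; true])).
  move=> /(_ _ (QRn _ (QAP_perm _ _))) h.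
  have /h : box_params (low n m.+2 [:: true; true]) finset.set0 (high n m.+2) 2.
    by apply: box_params_low => //; lia.
  have := box_form_perm R (low n m.+2 [:: true; true]) (high n m.+2)
    (swap_perm mn2 [:: true; true]).
  rewrite card_swap_perm //= /box_const.
  have -> : (2 : int)%:~R = 2 :> R by [].
  by lra.
apply/ereal_infP => _ [k [r [Qx [ext cardQ]]] <-].
rewrite lee_fin; apply: exp_lower_bound nm.
exact: facets_lower_bound m0 mn QRn valid ext cardQ.
Qed.
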